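(* For all $d\geq 2$, \[ \operatorname{asdim}_{\mathrm{poly}(d)}(\mathbb{H}^d)\leq d-1. \]
   Context: $\mathbb{H}^d$ is real hyperbolic $d$-space (replaced by a maximal $1$-separated subset). $\operatorname{asdim}_{\mathrm{poly}(d)}(X)$ is the least $n$ such that for every $r\geq 0$, $X=X_0\cup\dots\cup X_n$ with each $X_i$ a disjoint union of pieces pairwise at distance at least $r$, and there is $C$ such that every ball of radius $\rho$ in every piece (with the induced metric) has cardinality at most $C\rho^d+C$. *)

(* Defs.v *)
From HB Require Import structures.
From mathcomp Require Import all_boot all_order all_algebra.
From mathcomp Require Import boolp classical_sets reals exp.
Set Implicit Arguments. Unset Strict Implicit. Unset Printing Implicit Defensive.
Import Order.TTheory GRing.Theory Num.Theory.
Local Open Scope ring_scope.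
Local Open Scope classical_set_scope.

(* Hyperboloid model of real hyperbolic d-space H^d inside R^{d+1}
   (coordinate 0 is the "time" coordinate). *)
Definition minkowski (R : realType) (d : nat) (v w : 'rV[R]_d.+1) : R :=
  v ord0 ord0 * w ord0 ord0
  - \sum_(i < d.+1 | i != ord0) v ord0 i * w ord0 i.

Definition hyperbolic_space (R : realType) (d : nat) : set 'rV[R]_d.+1 :=
  [set v | minkowski v v = 1 /\ 0 < v ord0 ord0].

Definition arcosh (R : realType) (c : R) : R := ln (c + Num.sqrt (c ^+ 2 - 1)).

Definition hdist (R : realType) (d : nat) (v w : 'rV[R]_d.+1) : R :=
  arcosh (minkowski v w).

Definition maximal_1_separated (R : realType) (d : nat) (X : set 'rV[R]_d.+1) : Prop :=
  X `<=` @hyperbolic_space R d /\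
  (forall x y, X x -> X y -> x <> y -> 1 <= hdist x y) /\
  (forall z, @hyperbolic_space R d z -> ~ X z -> exists2 x, X x & hdist z x < 1).

(* asdim_{poly(k)}(X) <= n : for every r >= 0, X = X_0 u ... u X_n, each X_i
   the disjoint union of the pieces in the family P i, distinct pieces of the
   same family are at distance >= r, and there is C such that every (closed)
   ball of radius rho >= 0 in every piece (induced metric) has at most
   C rho^k + C points. *)
Definition asdim_poly_le (R : realType) (T : eqType) (dist : T -> T -> R)
    (X : set T) (k n : nat) : Prop :=
  forall r : R, 0 <= r ->
  exists P : 'I_n.+1 -> set (set T),
    (forall x, X x -> exists i, exists2 U, P i U & U x) /\
    (forall i U, P i U -> U `<=` X) /\
    (forall i U V, P i U -> P i V -> U <> V -> U `&` V = set0) /\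
    (forall i U V, P i U -> P i V -> U <> V ->
       forall u v, U u -> V v -> r <= dist u v) /\
    (exists C : R, forall i U x (rho : R), P i U -> U x -> 0 <= rho ->
       forall s : seq T, uniq s ->
       (forall y, y \in s -> U y /\ dist x y <= rho) ->
       (size s)%:R <= C * rho ^+ k + C).

(* Main.v *)
Require Import Defs.
From mathcomp Require Import all_boot all_order all_algebra.
From mathcomp Require Import boolp classical_sets reals exp.
From mathcomp Require Import sequences zify ring lra.
Set Implicit Arguments. Unset Strict Implicit. Unset Printing Implicit Defensive.
Import Order.TTheory GRing.Theory Num.Theory.
Local Open Scope ring_scope.

(** In the upper half-space model, forgetting all but one horospherical
    coordinate [x_j] and the height [h] is a 1-Lipschitz map to the hyperbolic
    plane, and [x_j |-> |x_j|] folds that plane onto a half of it.  On the folded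
    plane we construct [d] pairwise disjoint systems of walls such that, for each
    of them, the complement is a union of far apart pieces which meet every
    horocyclic level in a number of [b]-adic cells growing at most linearly with
    the distance.  A piece of colour [t] in [H^d] consists of the points whose
    [d - 1] projections avoid the [t]-th walls and lie in prescribed pieces.  A
    projection lies in walls of at most one colour, so each point has a colour
    that is good for all [d - 1] of them; a ball of radius [rho] in a piece meets
    [O(rho)] levels in [O(rho ^ (d - 1))] cells each.

    The planar walls come from a two-colouring ([true]/[false]) of the [b]-adic
    points: below a [b]-adic cell with interior points of colour [s], vertical
    lines of colour [s] start at these points, and a horizontal wall of colour
    [s] closes the top of each subcell both of whose ends have colour [s].  The
    two colours of walls stay far apart.  The walls of colour [true] cut the
    plane into pieces, and their neighbourhoods fall into pieces cut out by the
    walls of colour [false]; the [d] disjoint systems are the successive layers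
    [A_(t+1) \ A_t] of neighbourhoods [A_t] of the [true] walls. *)

(** * The two-coloured b-adic tree *)

Section TwoColouredTree.
Local Open Scope nat_scope.

(* A cell carries [(p, q, s)]: the colours of its left and right ends and of the
   interior subdivision points.  Flipping [s] in the children with two ends of
   colour [s] keeps [p = q = s] from ever occurring, and in the other children
   the unflipped [s] is what makes the growth below a cell linear. *)
Definition wall_step (b : nat) (st : bool * bool * bool) (j : nat) :=
  let: (p, q, s) := st in
  let p' := if j == 0 then p else s in
  let q' := if j.+1 == b then q else s in
  (p', q', if (p' == s) && (q' == s) then ~~ s else s).

(* The state of cell 0 is fixed by [wall_step b _ 0], so that cell [k] has the same
   state at all levels and the tree may be continued upwards for ever. *)
Fixpoint walls_rec (b n k : nat) : bool * bool * bool :=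
  if n is n'.+1 then
    if k == 0 then (true, false, false)
    else wall_step b (walls_rec b n' (k %/ b)) (k %% b)
  else (true, false, false).

Definition walls (b k : nat) := walls_rec b k k.
Definition lwall b k := (walls b k).1.1.
Definition rwall b k := (walls b k).1.2.
Definition inner b k := (walls b k).2.

Lemma walls_rec_fuel b n k : 1 < b -> k <= n -> walls_rec b n k = walls b k.
Proof.
move=> b1; elim/ltn_ind: n k => n IH k kn.
rewrite /walls; case: n IH kn => [|n] IH kn; first by have -> : k = 0 by lia.
case: k kn => [|k] kn //=.
have q1 : k.+1 %/ b < k.+1 by rewrite ltn_Pdiv.
by rewrite IH ?[in RHS]IH //; lia.
Qed.

Lemma wallsE b k : 1 < b -> walls b k = wall_step b (walls b (k %/ b)) (k %% b).
Proof.
move=> b1; case: k => [|k].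
  by rewrite div0n mod0n /=; case: b b1 => [|[|b]].
rewrite {1}/walls /= walls_rec_fuel //.
by have := ltn_Pdiv b1 (ltn0Sn k); lia.
Qed.

Lemma lwallE b k : 1 < b ->
  lwall b k = if k %% b == 0 then lwall b (k %/ b) else inner b (k %/ b).
Proof. by move=> b1; rewrite /lwall /inner wallsE //; case: (walls _ (_ %/ _)) => -[]. Qed.

Lemma rwallE b k : 1 < b ->
  rwall b k = if (k %% b).+1 == b then rwall b (k %/ b) else inner b (k %/ b).
Proof. by move=> b1; rewrite /rwall /inner wallsE //; case: (walls _ (_ %/ _)) => -[]. Qed.

Lemma innerE b k : 1 < b ->
  inner b k = if (lwall b k == inner b (k %/ b)) && (rwall b k == inner b (k %/ b))
              then ~~ inner b (k %/ b) else inner b (k %/ b).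
Proof.
move=> b1; rewrite /lwall /rwall /inner (wallsE _ b1).
by case: (walls b (k %/ b)) => -[].
Qed.

(** The flip in [wall_step] occurs exactly when both ends agree with the inherited interior colour;
    without a flip one end already differs from it. *)
Lemma walls_not_constant b k : 1 < b ->
  ~~ ((lwall b k == inner b k) && (rwall b k == inner b k)).
Proof.
move=> b1; rewrite innerE //.
by case: (lwall b k) (rwall b k) (inner b (k %/ b)) => -[] [].
Qed.

Lemma divnS_ndvd b k : 1 < b -> (k.+1 %% b == 0) = false -> k.+1 %/ b = k %/ b.
Proof. by move=> b1 h; rewrite divnS //; last lia; rewrite /dvdn h. Qed.

Lemma modn_pred b k : 1 < b -> ((k %% b).+1 == b) = (k.+1 %% b == 0).
Proof.
move=> b1; rewrite [in RHS](divn_eq k b) -addnS modnMDl.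
have : k %% b < b by rewrite ltn_mod; lia.
rewrite leq_eqVlt => /orP[/eqP ->|h]; first by rewrite eqxx modnn.
by rewrite [in RHS]modn_small // (ltn_eqF h).
Qed.

(** Colour thus belongs to a point, not to a cell: a point inside the parent takes its interior
    colour, and any other shared end is a shared end of the two parents. *)
Lemma rwall_lwall b k : 1 < b -> rwall b k = lwall b k.+1.
Proof.
move=> b1; elim/ltn_ind: k => k IH.
rewrite rwallE // lwallE // modn_pred //; case: ifP => h; last by rewrite divnS_ndvd.
rewrite divnS ?/dvdn ?h //; last lia.
case: k IH h => [|k] IH h; last by rewrite IH // ltn_Pdiv.
by move: h; rewrite modn_small.
Qed.

(** Indices [k] and, [t] levels lower, [k * b ^ t] denote the same point. *)
Lemma lwall_mulX b k t : 1 < b -> lwall b (k * b ^ t) = lwall b k.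
Proof.
move=> b1; elim: t => [|t IH]; first by rewrite muln1.
rewrite lwallE // expnSr mulnA modnMl mulnK //=; lia.
Qed.

Definition renewed b (i : bool) k :=
  [&& lwall b k == i, rwall b k == i & inner b (k %/ b) == i].

(* The label of a cell is the cell (level and index) below whose top its piece
   starts, or [None] when no ancestor is renewed; levels increase upwards. *)
Fixpoint label_rec b i n (a : int) k : option (int * nat) :=
  if renewed b i k then Some (a, k)
  else if n is n'.+1 then label_rec b i n' (a + 1)%R (k %/ b) else None.

Definition label b i (a : int) k := label_rec b i k a k.

Lemma renewed0 b i : renewed b i 0 = false.
Proof. by rewrite /renewed /lwall /rwall /=; case: i. Qed.

(** Division by [b] decreases a nonzero index, so [k] steps upwards reach cell 0, which is never
    renewed. *)
Lemma label_rec_fuel b i n a k : 1 < b -> k <= n ->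
  label_rec b i n a k = label b i a k.
Proof.
move=> b1; rewrite /label.
elim/ltn_ind: n a k => n IH a [|k] kn.
  elim: n a {IH kn} => //= n IH a.
  by rewrite div0n IH /= !renewed0.
case: n IH kn => [|n] IH kn //=; case: ifP => // _.
have q1 : k.+1 %/ b < k.+1 by rewrite ltn_Pdiv.
by rewrite IH ?[in RHS]IH //; lia.
Qed.

Lemma label_renewed b i a k : renewed b i k -> label b i a k = Some (a, k).
Proof. by rewrite /label; case: k => [|k] /= ->. Qed.

Lemma label_parent b i a k : 1 < b -> ~~ renewed b i k ->
  label b i a k = label b i (a + 1)%R (k %/ b).
Proof.
move=> b1 /negbTE rk; case: k rk => [|k] rk.
  by rewrite /label /= div0n /= renewed0.
rewrite {1}/label /= rk label_rec_fuel //.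
by have := ltn_Pdiv b1 (ltn0Sn k); lia.
Qed.

(** Neither cell has two ends of colour [i], so both take the label of their parent; the parents
    coincide or are adjacent at the same point, and the argument repeats. *)
Lemma label_adjacent b i a k : 1 < b -> lwall b k.+1 != i ->
  label b i a k = label b i a k.+1.
Proof.
move=> b1; elim/ltn_ind: k a => k IH a ci.
have rk : ~~ renewed b i k.
  by rewrite /renewed rwall_lwall // (negbTE ci) andbF.
have rk1 : ~~ renewed b i k.+1 by rewrite /renewed (negbTE ci).
rewrite (label_parent _ b1 rk) (label_parent _ b1 rk1).
case h : (k.+1 %% b == 0); last by rewrite divnS_ndvd.
move: ci; rewrite lwallE // h divnS ?/dvdn ?h //; last lia.
rewrite add1n.
case: k IH h {rk rk1} => [|k] IH h; last by apply: IH; rewrite ltn_Pdiv.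
by move: h; rewrite modn_small.
Qed.

Definition persistent b i t k := [forall u : 'I_t, ~~ renewed b i (k %/ b ^ u)].

Lemma label_persistent b i a t k : 1 < b ->
  persistent b i t k \/
  exists2 t1, t1 < t & label b i a k = Some ((a + t1%:Z)%R, k %/ b ^ t1) /\
                       persistent b i t1 k.
Proof.
move=> b1; elim: t => [|t [IH|[t1 t1t IH]]]; first by left; apply/forallP => -[].
  case rt : (renewed b i (k %/ b ^ t)).
    right; exists t => //; split => //.
    suff H u : u <= t -> label b i a k = label b i (a + u%:Z)%R (k %/ b ^ u).
      by rewrite (H t) // label_renewed.
    elim: u => [|u IHu] ut; first by rewrite GRing.addr0 divn1.
    rewrite IHu; last lia.
    rewrite label_parent //; last exact: (forallP IH (Ordinal ut)).
    by rewrite -divnMA -expnSr; congr label; lia.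
  left; apply/forallP => -[u ut] /=.
  have : u <= t by lia.
  rewrite leq_eqVlt => /orP[/eqP ->|ut']; first by rewrite rt.
  exact: (forallP IH (Ordinal ut')).
by right; exists t1 => //; lia.
Qed.

(** * Linear growth of persistent descendants *)

Fixpoint descendants b i t k : seq nat :=
  if t is t'.+1 then
    flatten [seq descendants b i t' (b * k + j) | j <- iota 0 b & ~~ renewed b i (b * k + j)]
  else [:: k].

Lemma mem_descendants b i t k : 1 < b -> persistent b i t k ->
  k \in descendants b i t (k %/ b ^ t).
Proof.
move=> b1; elim: t => [|t IH] pk; first by rewrite /= divn1 inE.
apply/flattenP; exists (descendants b i t (k %/ b ^ t)); last first.
  by apply/IH/forallP => -[u ut]; apply: (forallP pk (Ordinal (ltnW ut : u < t.+1))).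
apply/mapP; exists ((k %/ b ^ t) %% b).
  rewrite mem_filter mem_iota /= add0n ltn_mod; apply/andP; split; last lia.
  have := forallP pk (Ordinal (ltnSn t)).
  by rewrite {1}(divn_eq (k %/ b ^ t) b) mulnC -divnMA -expnSr.
by rewrite {1}(divn_eq (k %/ b ^ t) b) mulnC -divnMA -expnSr.
Qed.

(* The number of ends of colour [<> i] (if [s = i]), resp. [= i] (if [s <> i]), is
   preserved by the persistent children with the same [s]. *)
Definition descendant_bound b i t k :=
  if inner b k == i then (lwall b k != i) + (rwall b k != i)
  else ((lwall b k == i) + (rwall b k == i)) * (1 + 2 * b * t).

(** If the interior colour is [i], only end children whose outer end is not [i] survive. Otherwise
    children with two equal ends flip to interior colour [i] and contribute at most 2 from then on,
    so a level adds at most [2 * b]. *)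
Lemma size_descendants b i t k : 1 < b ->
  size (descendants b i t k) <= descendant_bound b i t k.
Proof.
move=> b1; elim: t k => [|t IH] k.
  have := walls_not_constant k b1; rewrite /descendant_bound /=.
  by case: (lwall b k) (rwall b k) (inner b k) i => -[] [] [].
rewrite /= size_flatten /shape -map_comp.
have dv j : j < b -> (b * k + j) %/ b = k.
  by move=> jb; rewrite mulnC divnMDl ?divn_small ?addn0 //; lia.
have md j : j < b -> (b * k + j) %% b = j.
  by move=> jb; rewrite mulnC modnMDl modn_small.
have lw j : j < b -> lwall b (b * k + j) = if j == 0 then lwall b k else inner b k.
  by move=> jb; rewrite lwallE // md // dv.
have rw j : j < b -> rwall b (b * k + j) = if j.+1 == b then rwall b k else inner b k.
  by move=> jb; rewrite rwallE // md // dv.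
rewrite sumnE big_map big_filter.
have -> : iota 0 b = index_iota 0 b by rewrite /index_iota subn0.
set L := lwall b k; set Rw := rwall b k; set s := inner b k.
(* A child contributes a constant plus a share for each end inherited from the parent; each end is
   inherited by exactly one child. *)
pose u (e : bool) : nat := if s == i then nat_of_bool (~~ e) else e * (1 + 2 * b * t).
pose F j := (if s == i then 0 else 2) + ((j == 0) * u (L == i) + (j.+1 == b) * u (Rw == i)).
apply: (@leq_trans (\sum_(0 <= j < b) F j)).
  rewrite big_mkcond /= !big_nat; apply: leq_sum => j /andP[_ jb]; rewrite /F /u.
  case: ifP => // nr.
  apply: (leq_trans (IH _)); move: nr.
  rewrite /renewed /descendant_bound (innerE (b * k + j)) // lw // rw // dv // -/L -/Rw -/s.
  case: (L) (Rw) (s) (i) (j == 0) (j.+1 == b) => -[] [] [] [] []; rewrite /=; lia.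
rewrite /F big_split /= sum_nat_const_nat subn0 big_split /=.
have S (P : pred nat) x j0 : j0 < b -> (forall j, j < b -> P j = (j == j0)) ->
    \sum_(0 <= j < b) P j * x = x.
  move=> j0b HP; rewrite big_mkord (bigD1 (Ordinal j0b)) //= HP // eqxx mul1n.
  rewrite big1 ?addn0 // => j; rewrite HP //.
  by rewrite -val_eqE /= => /negbTE ->.
rewrite (S (fun j => j == 0) _ 0); [|lia|by []].
rewrite (S (fun j => j.+1 == b) _ b.-1); [|lia|by move=> j _; apply/eqP/eqP; lia].
rewrite /u /descendant_bound -/L -/Rw -/s.
have := walls_not_constant k b1; rewrite -/L -/Rw -/s.
case: (L) (Rw) (s) (i) => -[] [] []; rewrite /=; lia.
Qed.

Lemma size_descendants_linear b i t k : 1 < b ->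
  size (descendants b i t k) <= 4 * b * t.+1.
Proof.
move=> b1; apply: (leq_trans (size_descendants _ _ _ b1)).
rewrite /descendant_bound; case: ifP => _.
  by case: (_ != _) (_ != _) => -[]; nia.
by case: (_ == _) (_ == _) => -[]; nia.
Qed.

(* The second part covers the case where the label [l] starts below level [a + t]. *)
Definition label_class b i (a : int) t m (l : option (int * nat)) : seq nat :=
  descendants b i t m ++
  if l is Some (a1, k1) then
    if `|a1 - a|%N < t then descendants b i `|a1 - a| k1 else [::] else [::].

Lemma size_label_class b i a t m l : 1 < b -> size (label_class b i a t m l) <= 8 * b * t.+1.
Proof.
move=> b1; rewrite size_cat.
have := size_descendants_linear i t m b1.
suff : size (if l is Some (a1, k1) then
    if `|a1 - a|%N < t then descendants b i `|a1 - a| k1 else [::] else [::]) <= 4 * b * t.+1.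
  by lia.
case: l => [[a1 k1]|] //; case: ifP => // h.
apply: (leq_trans (size_descendants_linear _ _ _ b1)).
by rewrite leq_mul2l; lia.
Qed.

Lemma mem_label_class b i a t k : 1 < b ->
  k \in label_class b i a t (k %/ b ^ t) (label b i a k).
Proof.
move=> b1; rewrite mem_cat.
have [pk|[t1 t1t [lt1 pk]]] := label_persistent i a t k b1.
  by rewrite mem_descendants.
apply/orP; right; rewrite lt1.
have -> : `|(a + t1%:Z)%R - a|%N = t1 by lia.
by rewrite t1t mem_descendants.
Qed.

End TwoColouredTree.

(** * Walls in the half-plane *)

Definition in_cell (R : realFieldType) (b : nat) (a : int) (k : nat) (x : R) : bool :=
  k%:R * b%:R ^ a <= x < k.+1%:R * b%:R ^ a.

Definition at_level (R : realFieldType) (b : nat) (G : R) (a : int) (h : R) : bool :=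
  b%:R ^ (a - 1) < G * h <= b%:R ^ a.

(* Cells of level [a] have width [b ^ a] and are used at the heights [h] with [G * h]
   of order [b ^ a], so that they are at least [G] wide hyperbolically.  The
   thickness of the walls around the lines and at the tops of the renewed cells
   is governed by [kap]. *)
Definition walled (R : realFieldType) (b : nat) (G kap x h : R) : Prop :=
  (exists a k, [/\ lwall b k, G * h <= kap * b%:R ^ a & `|x - k%:R * b%:R ^ a| <= kap * h]) \/
  (exists a k, [/\ renewed b true k, in_cell b a k x,
                   b%:R ^ a <= kap * (G * h) & G * h <= kap * b%:R ^ a]).

Definition close (R : realFieldType) (E x h x' h' : R) : Prop :=
  [/\ `|x - x'| <= E * h, `|x - x'| <= E * h', h <= E * h' & h' <= E * h].

Lemma nearby_index (R : realFieldType) b a k e (x : R) : (0 < b)%N -> in_cell b a k x ->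
  `|x - e%:R * b%:R ^ a| < b%:R ^ a -> (e == k) || (e == k.+1).
Proof.
move=> b0 /andP[kx xk]; rewrite ltr_norml => /andP[h1 h2].
have w0 : 0 < b%:R ^ a :> R by rewrite exprz_gt0 // ltr0n.
have : (e%:R : R) < k.+2%:R.
  rewrite -(ltr_pM2r w0); rewrite -natr1 mulrDl in xk; rewrite -!natr1 !mulrDl; lra.
have : (k%:R : R) < e.+1%:R.
  by rewrite -(ltr_pM2r w0) -natr1 !mulrDl; lra.
rewrite !ltr_nat; lia.
Qed.

Lemma in_cell_inj (R : realFieldType) b a k m (x : R) : (0 < b)%N ->
  in_cell b a k x -> in_cell b a m x -> k = m.
Proof.
move=> b0 /andP[kx xk] /andP[mx xm].
have w0 : 0 < b%:R ^ a :> R by rewrite exprz_gt0 // ltr0n.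
have := le_lt_trans kx xm; have := le_lt_trans mx xk.
rewrite !ltr_pM2r // !ltr_nat; lia.
Qed.

Lemma scale_split (R : realFieldType) b (a : int) : (0 < b)%N ->
  b%:R ^ a = b%:R * b%:R ^ (a - 1) :> R.
Proof.
move=> b0; rewrite -{2}(expr1z (b%:R : R)) -expfzDr; last by rewrite pnatr_eq0; lia.
by congr (_ ^ _); lia.
Qed.

Lemma in_cell_parent (R : realFieldType) b a k (x : R) : (0 < b)%N ->
  in_cell b a k x -> in_cell b (a + 1) (k %/ b) x.
Proof.
move=> b0 /andP[kx xk]; rewrite /in_cell (@scale_split _ _ (a + 1)) //.
have -> : a + 1 - 1 = a by lia.
have w0 : 0 < b%:R ^ a :> R by rewrite exprz_gt0 // ltr0n.
rewrite !mulrA -!natrM; apply/andP; split.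
  apply: le_trans kx; rewrite ler_pM2r // ler_nat; exact: leq_divM.
by apply: lt_le_trans xk _; rewrite ler_pM2r // ler_nat ltn_ceil.
Qed.

Lemma in_cell_ancestor (R : realFieldType) b a k t (x : R) : (0 < b)%N ->
  in_cell b a k x -> in_cell b (a + t%:Z) (k %/ b ^ t) x.
Proof.
move=> b0 kx; elim: t => [|t IH]; first by rewrite addr0 divn1.
rewrite expnSr divnMA; have -> : (a + t.+1%:Z = (a + t%:Z) + 1)%R by lia.
exact: in_cell_parent.
Qed.

Lemma walled_mono (R : realFieldType) b (G kap kap' x h : R) : (0 < b)%N -> 0 < G ->
  kap <= kap' -> 0 < h -> walled b G kap x h -> walled b G kap' x h.
Proof.
move=> b0 G0 kk h0.
have w0 (a : int) : 0 < b%:R ^ a :> R by rewrite exprz_gt0 // ltr0n.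
case=> -[a [k]]; [case=> p1 p2 p3; left|case=> p1 p2 p3 p4; right];
  exists a, k; split => //.
- by apply: (le_trans p2); rewrite ler_pM2r.
- by apply: (le_trans p3); rewrite ler_pM2r.
- by apply: (le_trans p3); rewrite ler_pM2r // mulr_gt0.
- by apply: (le_trans p4); rewrite ler_pM2r.
Qed.

Section Walls.
Context (R : realFieldType) (b : nat) (E kap G : R).
Hypotheses (b1 : (1 < b)%N) (E1 : 1 <= E) (Ekap : E ^+ 2 <= kap)
  (kapG : 4 * kap ^+ 2 <= G) (Ekapb : E * kap < b%:R).

Let b0 : (0 < b)%N. Proof. exact: ltnW. Qed.
Let w0 (a : int) : 0 < b%:R ^ a :> R. Proof. by rewrite exprz_gt0 // ltr0n. Qed.
Let E_kap : E <= kap. Proof. by have := Ekap; have := E1; nra. Qed.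
Let kap1 : 1 <= kap. Proof. exact: le_trans E1 E_kap. Qed.
Let kapb : kap < b%:R. Proof. by have := Ekapb; have := E1; have := kap1; nra. Qed.
Let G4 : 4 * kap <= G. Proof. by have := kapG; have := kap1; nra. Qed.
Let G0 : 0 < G. Proof. by have := G4; have := kap1; lra. Qed.

Let E0 : 0 < E. Proof. exact: lt_le_trans ltr01 E1. Qed.
Let kap0 : 0 < kap. Proof. exact: lt_le_trans ltr01 kap1. Qed.

Lemma ltr_scale (a a' : int) : (b%:R ^ a < b%:R ^ a' :> R) = (a < a').
Proof. by rewrite ltr_eXz2l // ltr1n. Qed.

(** A point that leaves the top wall of a renewed cell sideways is near an end of that cell, where a
    line of colour [true] stands. The new thickness absorbs [E * h' + kap * h <= E * h' + kap * E *
    h']. *)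
Lemma walled_widen (x h x' h' : R) : 0 < h -> 0 < h' ->
  close E x h x' h' -> walled b G kap x h -> walled b G (2 * E * kap) x' h'.
Proof.
move=> h0 h0' [d1 d2 hh1 hh2].
have line a k : lwall b k -> G * h <= kap * b%:R ^ a ->
    `|x' - k%:R * b%:R ^ a| <= E * h' + kap * h -> walled b G (2 * E * kap) x' h'.
  move=> lk le1 le2; left; exists a, k; split => //.
    have Gh : G * h' <= E * (G * h) by rewrite mulrCA ler_pM2l.
    have : E * (G * h) <= E * (kap * b%:R ^ a) by rewrite ler_pM2l.
    have : 0 < E * (kap * b%:R ^ a) by rewrite !mulr_gt0.
    lra.
  apply: le_trans le2 _.
  have : kap * h <= kap * (E * h') by rewrite ler_pM2l.
  have : E * h' <= E * kap * h' by rewrite ler_pM2r // ler_peMr // ltW.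
  lra.
case=> -[a [k]].
  case=> lk le1 le2; apply: (line a k) => //.
  have := ler_distD x x' (k%:R * b%:R ^ a); rewrite (distrC x' x); lra.
case=> rk kx le1 le2.
have Gh : G * h' <= E * (G * h) by rewrite mulrCA ler_pM2l.
have Gh2 : G * h <= E * (G * h') by rewrite mulrCA ler_pM2l.
have G0' : 0 < G * h' by rewrite mulr_gt0.
have kh : 0 < kap * h by rewrite mulr_gt0.
have /and3P[/eqP lk /eqP rwk _] := rk.
have [/andP[x1 x2]] := (kx, d2).
rewrite ler_norml => /andP[d3 d4].
case: (ltP x' (k%:R * b%:R ^ a)) => [lt1|ge1].
  by apply: (line a k); rewrite ?lk // ler_norml; lra.
case: (ltP x' (k.+1%:R * b%:R ^ a)) => [lt2|ge2]; last first.
  by apply: (line a k.+1); rewrite -?rwall_lwall ?rwk // ler_norml; lra.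
right; exists a, k; split => //; first by apply/andP.
  have : kap * (G * h) <= kap * (E * (G * h')) by rewrite ler_pM2l.
  have : 0 < kap * (E * (G * h')) by rewrite !mulr_gt0.
  lra.
have : E * (G * h) <= E * (kap * b%:R ^ a) by rewrite ler_pM2l.
have : 0 < E * (kap * b%:R ^ a) by rewrite !mulr_gt0.
lra.
Qed.

(** As [kap < b], no wall of a level below [a - 1] reaches this height. The cases are a line at an
    end of [k], the top of [k] itself, and a line or top belonging to a subcell of [k]. *)
Lemma walled_cases (x h : R) a k : 0 < h -> walled b G kap x h -> at_level b G a h -> in_cell b a k x ->
  [\/ exists2 e, lwall b e /\ (e == k) || (e == k.+1) & `|x - e%:R * b%:R ^ a| <= kap * h,
      lwall b k /\ rwall b k |
      [/\ inner b k, G * h <= kap * b%:R ^ (a - 1)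
        & forall e, lwall b e = false -> b%:R ^ (a - 1) / 2 <= `|x - e%:R * b%:R ^ a|] ].
Proof.
move=> h0 wd /andP[lo hi] kx.
set w1 : R := b%:R ^ (a - 1) in lo *.
have w10 : 0 < w1 by exact: w0.
have wE : b%:R ^ a = b%:R * w1 :> R by exact: scale_split.
have gap (n m : nat) : n != m -> 1 <= `|n%:R - m%:R : R|.
  rewrite neq_ltn => /orP[] nm.
    by rewrite distrC ger0_norm -?natrB ?ler1n ?ler0n ?subn_gt0 // ltnW.
  by rewrite ger0_norm -?natrB ?ler1n ?ler0n ?subn_gt0 // ltnW.
have kaph : kap * h <= b%:R ^ a / 4.
  rewrite ler_pdivlMr // mulrAC (mulrC kap); apply: le_trans hi.
  by rewrite ler_pM2r.
have low a1 : G * h <= kap * b%:R ^ a1 -> a - 1 <= a1.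
  move=> le1; rewrite -ltzD1 -ltr_scale (@scale_split R b (a1 + 1)) //.
  rewrite addrK.
  by apply: (lt_trans lo); apply: (le_lt_trans le1); rewrite ltr_pM2r.
have near e : lwall b e -> `|x - e%:R * b%:R ^ a| <= kap * h ->
    exists2 e, lwall b e /\ (e == k) || (e == k.+1) & `|x - e%:R * b%:R ^ a| <= kap * h.
  move=> le d; exists e => //; split => //; apply: (nearby_index b0 kx).
  by apply: le_lt_trans d _; have := w0 a; lra.
case: wd => -[a1 [k1]].
  case=> lk le1 d; have la := low _ le1.
  case: (leP a a1) => aa1.
    apply: Or31; apply: (near (k1 * b ^ `|a1 - a|)%N); first by rewrite lwall_mulX.
    move: d; suff -> : (k1 * b ^ `|a1 - a|)%N%:R * b%:R ^ a = k1%:R * b%:R ^ a1 :> R by [].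
    rewrite natrM natrX -mulrA; congr (_ * _).
    rewrite exprnP -expfzDr; last by rewrite pnatr_eq0 -lt0n.
    by congr (_ ^ _); clear -aa1; lia.
  have a1E : a1 = a - 1 by clear -la aa1; lia.
  rewrite a1E -/w1 in le1 d.
  case bk : (k1 %% b == 0)%N.
    apply: Or31; apply: (near (k1 %/ b)%N); first by move: lk; rewrite lwallE // bk.
    by rewrite wE mulrA -natrM divnK.
  (* Here [G * h <= kap * w1], and [4 * kap ^ 2 <= G] leaves the line a half-width of at most a
     quarter of a subcell. *)
  have kq : kap * h <= w1 / 4.
    have : 4 * kap ^+ 2 * h <= kap * w1 by apply: le_trans le1; rewrite ler_pM2r.
    have -> : 4 * kap ^+ 2 * h = kap * (4 * (kap * h)) by ring.
    rewrite ler_pM2l //; lra.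
  have kE : (k1 %/ b)%N = k.
    have /andP[x1 x2] := kx; move: d; rewrite ler_norml => /andP[d1 d2].
    rewrite wE mulrA -natrM in x1; rewrite wE mulrA -natrM in x2.
    have : ((k * b)%:R : R) < k1.+1%:R.
      by rewrite -(ltr_pM2r w10) -(natr1 k1) mulrDl; lra.
    have : (k1%:R : R) < (k.+1 * b).+1%:R.
      by rewrite -(ltr_pM2r w10) -(natr1 (k.+1 * b)) mulrDl; lra.
    rewrite !ltr_nat => u1 u2.
    apply/eqP; rewrite eqn_leq leq_divRL // -ltnS ltn_divLR //.
    have : k1 != (k.+1 * b)%N by apply/eqP => kk; move: bk; rewrite kk modnMl.
    clear -u1 u2; lia.
  apply: Or33; split => //; first by move: lk; rewrite lwallE // bk kE.
  move=> e le.
  have ne : k1 != (e * b)%N by apply/eqP => kk; move: bk; rewrite kk modnMl.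
  have := ler_distD x (k1%:R * w1) (e%:R * b%:R ^ a).
  rewrite {1}wE mulrA -natrM -mulrBl normrM (gtr0_norm w10).
  have := gap _ _ ne; rewrite (distrC _ x) => g1.
  have : w1 <= `|k1%:R - (e * b)%:R| * w1 by rewrite ler_peMl // ltW.
  lra.
case=> rk kx1 le0 le1; have la := low _ le1.
have la2 : a1 <= a.
  rewrite -ltzD1 -ltr_scale (@scale_split R b (a + 1)) //.
  rewrite addrK.
  apply: (le_lt_trans le0); apply: (@le_lt_trans _ _ (kap * b%:R ^ a)).
    by rewrite ler_pM2l.
  by rewrite ltr_pM2r.
have /and3P[/eqP lk /eqP rwk /eqP ik] := rk.
case: (leP a a1) => aa1.
  have a1E : a1 = a by clear -la2 aa1; lia.
  by apply: Or32; rewrite a1E in kx1; rewrite (in_cell_inj b0 kx kx1) lk rwk.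
have a1E : a1 = a - 1 by clear -la aa1; lia.
rewrite a1E -/w1 in kx1 le0 le1.
have kE : (k1 %/ b)%N = k.
  have := in_cell_parent b0 kx1; rewrite subrK.
  by move=> kx2; rewrite (in_cell_inj b0 kx2 kx).
apply: Or33; split => //; first by rewrite -kE ik.
move=> e le.
have leb : lwall b (e * b)%N = false by have := lwall_mulX e 1 b1; rewrite expn1 le.
have ne1 : k1 != (e * b)%N by apply/eqP => kk; move: leb; rewrite -kk lk.
have ne2 : k1.+1 != (e * b)%N by apply/eqP => kk; move: leb; rewrite -kk -rwall_lwall // rwk.
have /andP[x1 x2] := kx1; rewrite -/w1 in x1 x2.
rewrite wE mulrA -natrM.
case: (ltnP (e * b) k1) => ek.
  have : (e * b).+1%:R * w1 <= k1%:R * w1 by rewrite ler_pM2r // ler_nat.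
  by rewrite -(natr1 (e * b)) mulrDl => u; rewrite ger0_norm; lra.
have : k1.+2%:R * w1 <= (e * b)%:R * w1 by rewrite ler_pM2r // ler_nat; clear -ek ne1 ne2; lia.
by rewrite -(natr1 k1.+1) mulrDl => u; rewrite ler0_norm; lra.
Qed.
Lemma walled_far_end (x h : R) a k (e : nat) : 0 < h -> walled b G kap x h -> at_level b G a h ->
  in_cell b a k x -> (e == k) || (e == k.+1) -> lwall b e = false ->
  E * h < `|x - e%:R * b%:R ^ a|.
Proof.
move=> h0 wd lev kx ek le.
have Eh : E * h <= kap * h by rewrite ler_pM2r.
have kh0 : 0 < kap * h by rewrite mulr_gt0.
have /andP[_ hi] := lev.
have hw : 4 * (kap * h) <= b%:R ^ a.
  by apply: le_trans hi; rewrite mulrA ler_pM2r.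
have [[e' [le' ek'] d]|[lk rk]|[_ le1 /(_ e le) d]] := walled_cases h0 wd lev kx.
- have w : (b%:R ^ a : R) <= `|e%:R * b%:R ^ a - e'%:R * b%:R ^ a|.
    case/orP: ek le => /eqP -> le; case/orP: ek' le' => /eqP ->; rewrite ?le //.
      by move=> _; rewrite -natr1 mulrDl mul1r opprD addrA subrr add0r normrN ger0_norm // ltW.
    by move=> _; rewrite -natr1 mulrDl mul1r addrAC subrr add0r ger0_norm // ltW.
  by have := ler_distD x (e%:R * b%:R ^ a) (e'%:R * b%:R ^ a); rewrite (distrC _ x); lra.
- by case/orP: ek le => /eqP ->; rewrite ?lk // -rwall_lwall // rk.
- apply: lt_le_trans d; apply: (le_lt_trans Eh).
  rewrite ltr_pdivlMr //.
  have : 4 * kap ^+ 2 * h <= kap * b%:R ^ (a - 1) by apply: le_trans le1; rewrite ler_pM2r.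
  have -> : 4 * kap ^+ 2 * h = kap * (4 * (kap * h)) by ring.
  by rewrite ler_pM2l //; lra.
Qed.

(** The last hypothesis places the point near the top of its level, where [E * kap < b] excludes the
    third case of [walled_cases]; the other two give [k] an end of colour [true]. *)
Lemma walled_not_renewed (x h : R) a k : 0 < h -> walled b G kap x h -> at_level b G a h ->
  in_cell b a k x -> b%:R ^ a <= E * (G * h) -> ~~ renewed b false k.
Proof.
move=> h0 wd lev kx lo; apply/negP => /and3P[/eqP lk /eqP rk _].
have [[e [le ek] d]|[lk' _]|[_ le1 _]] := walled_cases h0 wd lev kx.
- by case/orP: ek le => /eqP ->; rewrite ?lk // -rwall_lwall // rk.
- by rewrite lk in lk'.
- have : b%:R * b%:R ^ (a - 1) <= E * kap * b%:R ^ (a - 1).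
    by rewrite -scale_split //; apply: (le_trans lo); rewrite -mulrA ler_pM2l.
  by rewrite ler_pM2r // leNgt Ekapb.
Qed.

Lemma label_lateral i a k m (x x' h : R) : in_cell b a k x -> in_cell b a m x' ->
  `|x - x'| <= E * h -> E * h < b%:R ^ a ->
  (forall e, (e == k) || (e == k.+1) -> lwall b e = i -> E * h < `|x - e%:R * b%:R ^ a|) ->
  label b i a k = label b i a m.
Proof.
move=> /andP[x1 x2] /andP[x3 x4] d hw far.
have := d; rewrite ler_norml => /andP[d1 d2].
have adj n : lwall b n.+1 != i -> label b i a n = label b i a n.+1 by exact: label_adjacent.
case: (ltngtP k m) => [km|mk|-> //].
- have mE : m = k.+1.
    have : (m%:R : R) < k.+2%:R.
      by rewrite -(ltr_pM2r (w0 a)) -(natr1 k.+1) mulrDl; lra.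
    by rewrite ltr_nat; clear -km; lia.
  subst m; apply: adj; apply/eqP => le.
  have := far k.+1; rewrite eqxx orbT => /(_ isT le).
  apply/negP; rewrite -leNgt; apply: le_trans d.
  by rewrite !ler0_norm; lra.
- have kE : k = m.+1.
    have : (k%:R : R) < m.+2%:R.
      by rewrite -(ltr_pM2r (w0 a)) -(natr1 m.+1) mulrDl; lra.
    by rewrite ltr_nat; clear -mk; lia.
  subst k; symmetry; apply: adj; apply/eqP => le.
  have := far m.+1; rewrite eqxx => /(_ isT le).
  apply/negP; rewrite -leNgt; apply: le_trans d.
  by rewrite !ger0_norm; lra.
Qed.

(** The levels differ by at most one. If [a'] is lower, [h'] is within a factor [E] of the top of
    its level, so [k'] is not renewed and shares the label of its parent; what remains is a
    horizontal move. *)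
Lemma label_close i (x h : R) a k (x' h' : R) a' k' : 0 < h -> 0 < h' -> close E x h x' h' -> a' <= a ->
  at_level b G a h -> at_level b G a' h' -> in_cell b a k x -> in_cell b a' k' x' ->
  (forall e, (e == k) || (e == k.+1) -> lwall b e = i -> E * h < `|x - e%:R * b%:R ^ a|) ->
  (b%:R ^ a' <= E * (G * h') -> ~~ renewed b i k') ->
  label b i a k = label b i a' k'.
Proof.
move=> h0 h0' [d1 _ hh _] aa' /andP[lo hi] /andP[_ hi'] kx kx' far nr.
have hw : E * h < b%:R ^ a.
  apply: lt_le_trans hi; rewrite ltr_pM2r //.
  by have := E_kap; have := G4; have := kap0; lra.
have Gh : G * h <= E * (G * h') by rewrite mulrCA ler_pM2l.
have la : a - 1 <= a'.
  rewrite -ltzD1 -ltr_scale (@scale_split R b (a' + 1)) // addrK.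
  apply: (lt_le_trans lo); apply: (le_trans Gh).
  apply: (@le_trans _ _ (E * b%:R ^ a')); first by rewrite ler_pM2l.
  by rewrite ler_pM2r //; have := E_kap; have := kapb; lra.
case: (eqVneq a' a) => [aE|ne].
  by rewrite aE in kx' *; exact: (label_lateral kx kx' d1 hw far).
have aE : a' = a - 1 by clear -la aa' ne; lia.
have nr' : ~~ renewed b i k' by apply: nr; rewrite aE; apply/ltW/lt_le_trans/Gh.
rewrite (label_parent a' b1 nr').
have := in_cell_parent b0 kx'; rewrite aE subrK => kx2.
exact: (label_lateral kx kx2 d1 hw far).
Qed.

Lemma close_sym (x h x' h' : R) : close E x h x' h' -> close E x' h' x h.
Proof. by case=> d1 d2 d3 d4; split; rewrite // distrC. Qed.

Lemma walled_label (x h : R) a k (x' h' : R) a' k' : 0 < h -> 0 < h' -> close E x h x' h' ->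
  at_level b G a h -> at_level b G a' h' -> in_cell b a k x -> in_cell b a' k' x' ->
  walled b G kap x h -> walled b G kap x' h' ->
  label b false a k = label b false a' k'.
Proof.
move=> h0 h0' cl lev lev' kx kx' wd wd'.
case: (leP a' a) => [aa'|/ltW aa'].
  apply: (label_close h0 h0' cl aa' lev lev' kx kx') => [e ek le|lo].
    exact: (walled_far_end h0 wd lev kx ek le).
  exact: (walled_not_renewed h0' wd' lev' kx' lo).
symmetry; apply: (label_close h0' h0 (close_sym cl) aa' lev' lev kx' kx) => [e ek le|lo].
  exact: (walled_far_end h0' wd' lev' kx' ek le).
exact: (walled_not_renewed h0 wd lev kx lo).
Qed.

Lemma unwalled_far_end (x h : R) a (e : nat) : 0 < h -> ~ walled b G kap x h -> at_level b G a h ->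
  lwall b e = true -> E * h < `|x - e%:R * b%:R ^ a|.
Proof.
move=> h0 wd /andP[_ hi] le; rewrite ltNge; apply/negP => d; apply: wd; left.
exists a, e; split => //; first by apply: (le_trans hi); rewrite ler_peMl // ltW.
by apply: (le_trans d); rewrite ler_pM2r.
Qed.

Lemma unwalled_not_renewed (x h : R) a k : 0 < h -> ~ walled b G kap x h -> at_level b G a h ->
  in_cell b a k x -> b%:R ^ a <= E * (G * h) -> ~~ renewed b true k.
Proof.
move=> h0 wd /andP[_ hi] kx lo; apply/negP => rk; apply: wd; right.
exists a, k; split => //; last by apply: (le_trans hi); rewrite ler_peMl // ltW.
by apply: (le_trans lo); rewrite ler_pM2r // mulr_gt0.
Qed.

Lemma unwalled_label (x h : R) a k (x' h' : R) a' k' : 0 < h -> 0 < h' -> close E x h x' h' ->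
  at_level b G a h -> at_level b G a' h' -> in_cell b a k x -> in_cell b a' k' x' ->
  ~ walled b G kap x h -> ~ walled b G kap x' h' ->
  label b true a k = label b true a' k'.
Proof.
move=> h0 h0' cl lev lev' kx kx' wd wd'.
case: (leP a' a) => [aa'|/ltW aa'].
  apply: (label_close h0 h0' cl aa' lev lev' kx kx') => [e ek le|lo].
    exact: (unwalled_far_end h0 wd lev le).
  exact: (unwalled_not_renewed h0' wd' lev' kx' lo).
symmetry; apply: (label_close h0' h0 (close_sym cl) aa' lev' lev kx' kx) => [e ek le|lo].
  exact: (unwalled_far_end h0' wd' lev' le).
exact: (unwalled_not_renewed h0 wd lev kx lo).
Qed.

End Walls.

(** * Horospherical coordinates *)

Definition level (R : realType) (b : nat) (G h : R) : int :=
  Num.ceil (ln (G * h) / ln b%:R).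

Definition cell_index (R : realType) (b : nat) (a : int) (x : R) : nat :=
  Num.truncn (x / b%:R ^ a).

Lemma exprz_expR (R : realType) (b : nat) (a : int) : (0 < b)%N ->
  b%:R ^ a = expR (a%:~R * ln b%:R) :> R.
Proof.
move=> b0; case: a => [n|n].
  by rewrite expRM_natl lnK // posrE ltr0n.
by rewrite NegzE mulrNz mulNr expRN expRM_natl lnK ?posrE ?ltr0n.
Qed.

Lemma levelP (R : realType) (b : nat) (G h : R) : (1 < b)%N -> 0 < G * h ->
  at_level b G (level b G h) h.
Proof.
move=> b1 Gh; have b0 := ltnW b1.
have lb : 0 < ln (b%:R : R) by rewrite ln_gt0 // ltr1n.
rewrite /at_level !exprz_expR // -[G * h]lnK ?posrE // ltr_expR ler_expR.
by rewrite -ltr_pdivlMr // -ler_pdivrMr // ceil_itv.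
Qed.

Lemma cell_indexP (R : realType) (b : nat) (a : int) (x : R) : (0 < b)%N -> 0 <= x ->
  in_cell b a (cell_index b a x) x.
Proof.
move=> b0 x0; have w0 : 0 < b%:R ^ a :> R by rewrite exprz_gt0 // ltr0n.
by rewrite /in_cell -ler_pdivlMr // -ltr_pdivrMr // truncn_itv // divr_ge0 // ltW.
Qed.

Section Coordinates.
Context (R : realType) (n : nat).
Implicit Types v w : 'rV[R]_n.+3.

(** Upper half-space coordinates: the point at infinity is the null vector with entries 1 at [ord0]
    and [ord_max], whose pairing with [v] is the inverse height. Here [d = n + 2]. *)
Definition height v : R := (v ord0 ord0 - v ord0 ord_max)^-1.
Definition horo v (j : 'I_n.+1) : R :=
  v ord0 (lift ord0 (widen_ord (leqnSn n.+1) j)) * height v.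

Lemma minkowski_split v w : minkowski v w =
  v ord0 ord0 * w ord0 ord0 - \sum_(j < n.+1)
     v ord0 (lift ord0 (widen_ord (leqnSn n.+1) j)) * w ord0 (lift ord0 (widen_ord (leqnSn n.+1) j))
  - v ord0 ord_max * w ord0 ord_max.
Proof.
rewrite /minkowski big_mkcond big_ord_recl /= add0r big_ord_recr /=.
by rewrite opprD addrA; congr (_ - _ - _ * _); congr (_ _ _); apply: val_inj.
Qed.

Lemma time_gt_last v : hyperbolic_space v -> 0 < v ord0 ord0 - v ord0 ord_max.
Proof.
case; rewrite minkowski_split; set S := \sum_(_ < _) _ => eq1 v0.
have S0 : 0 <= S by apply: sumr_ge0 => j _; rewrite -expr2 sqr_ge0.
by rewrite ltNge; apply/negP => h; nra.
Qed.

Lemma height_gt0 v : hyperbolic_space v -> 0 < height v.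
Proof. by move=> hv; rewrite invr_gt0 time_gt_last. Qed.

(** The half-space formula for the hyperbolic cosine of the distance, cleared of denominators. *)
Lemma minkowski_horo v w : hyperbolic_space v -> hyperbolic_space w ->
  2 * height v * height w * minkowski v w =
  height v ^+ 2 + height w ^+ 2 + \sum_(j < n.+1) (horo v j - horo w j) ^+ 2.
Proof.
move=> hv hw.
have := time_gt_last hv; have := time_gt_last hw.
move: hv hw => [+ _] [+ _]; rewrite !minkowski_split /height.
set V := fun j => v ord0 (lift ord0 (widen_ord (leqnSn n.+1) j)).
set W := fun j => w ord0 (lift ord0 (widen_ord (leqnSn n.+1) j)).
set vl := v ord0 ord_max; set wl := w ord0 ord_max.
set v0 := v ord0 ord0; set w0 := w ord0 ord0.
have -> : \sum_(j < n.+1) (horo v j - horo w j) ^+ 2 =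
    (v0 - vl)^-1 ^+ 2 * (\sum_(j < n.+1) V j * V j)
    - 2 * (v0 - vl)^-1 * (w0 - wl)^-1 * (\sum_(j < n.+1) V j * W j)
    + (w0 - wl)^-1 ^+ 2 * (\sum_(j < n.+1) W j * W j).
  rewrite !mulr_sumr -sumrB -big_split /=; apply: eq_bigr => j _.
  by rewrite /horo /height -/(V j) -/(W j) -/v0 -/w0 -/vl -/wl; ring.
rewrite -/(V _).
set S1 := \sum_(_ < _) V _ * V _; set S2 := \sum_(_ < _) V _ * W _.
set S3 := \sum_(_ < _) W _ * W _.
move=> e1 e2 w1 v1.
have -> : S1 = v0 * v0 - vl * vl - 1 by lra.
have -> : S3 = w0 * w0 - wl * wl - 1 by lra.
by field; rewrite !gt_eqF.
Qed.

Lemma minkowski_sym v w : minkowski v w = minkowski w v.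
Proof. by rewrite /minkowski mulrC; under eq_bigr do rewrite mulrC. Qed.

Lemma minkowski_gt0 v w : hyperbolic_space v -> hyperbolic_space w -> 0 < minkowski v w.
Proof.
move=> hv hw; have h0 := height_gt0 hv; have g0 := height_gt0 hw.
have hg : 0 < 2 * height v * height w by rewrite !mulr_gt0.
rewrite -(pmulr_rgt0 _ hg) minkowski_horo // ltr_wpDr ?addr_gt0 ?exprn_gt0 //.
by apply: sumr_ge0 => j _; exact: sqr_ge0.
Qed.

(** Every square in [minkowski_horo] is at most [height v * K] with [K = 2 * c * height w]; the
    first square gives [height v <= K], so all are at most [K ^ 2]. *)
Lemma horo_bound v w (c : R) : hyperbolic_space v -> hyperbolic_space w ->
  minkowski v w <= c -> height v <= 2 * c * height w /\
  (forall j, `|horo v j - horo w j| <= 2 * c * height w).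
Proof.
move=> hv hw le_c; have h0 := height_gt0 hv; have g0 := height_gt0 hw.
have c0 := lt_le_trans (minkowski_gt0 hv hw) le_c.
have := minkowski_horo hv hw.
have S0 (P : pred 'I_n.+1) : 0 <= \sum_(j < n.+1 | P j) (horo v j - horo w j) ^+ 2.
  by apply: sumr_ge0 => j _; exact: sqr_ge0.
have : 2 * height v * height w * minkowski v w <= height v * (2 * c * height w).
  by rewrite [leRHS](_ : _ = 2 * height v * height w * c); [rewrite ler_pM2l ?mulr_gt0|ring].
set K := 2 * c * height w => le1 eq1; rewrite eq1 {eq1} in le1.
have K0 : 0 < K by rewrite !mulr_gt0.
have hK : height v <= K.
  rewrite -(ler_pM2l h0) -expr2; apply: le_trans le1.
  by rewrite -addrA lerDl addr_ge0 ?sqr_ge0 ?(S0 predT).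
split=> // j.
rewrite -(@ler_pXn2r _ 2) ?nnegrE ?normr_ge0 ?(ltW K0) // real_normK ?num_real //.
apply: (@le_trans _ _ (height v * K)); last by rewrite expr2 ler_pM2r.
apply: le_trans le1; rewrite (bigD1 j) //= addrCA lerDl.
by rewrite addr_ge0 ?addr_ge0 ?sqr_ge0.
Qed.

Lemma hdist_le v w (rho : R) : hyperbolic_space v -> hyperbolic_space w ->
  hdist v w <= rho -> minkowski v w <= expR rho.
Proof.
move=> hv hw; rewrite /hdist /arcosh; set c := minkowski v w => le1.
have c0 : 0 < c by exact: minkowski_gt0.
have s0 : 0 <= Num.sqrt (c ^+ 2 - 1) by rewrite sqrtr_ge0.
have : c + Num.sqrt (c ^+ 2 - 1) <= expR rho.
  by rewrite -[leLHS]lnK ?ler_expR // posrE ltr_pwDl.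
lra.
Qed.

(* From [e >= 2] alone one gets [cosh 1 >= (2 + 1 / 2) / 2 = 5 / 4]. *)
Lemma hdist_ge1 v w : hyperbolic_space v -> hyperbolic_space w ->
  1 <= hdist v w -> 5 / 4 <= minkowski v w.
Proof.
move=> hv hw; rewrite /hdist /arcosh; set c := minkowski v w => le1.
have c0 : 0 < c by exact: minkowski_gt0.
have s0 : 0 <= Num.sqrt (c ^+ 2 - 1) by rewrite sqrtr_ge0.
have : expR 1 <= c + Num.sqrt (c ^+ 2 - 1).
  by rewrite -[leRHS]lnK ?ler_expR // posrE ltr_pwDl.
have := expR_ge1Dx (1 : R) => e1 e2.
rewrite leNgt; apply/negP => c54.
have e3 : 2 - c <= Num.sqrt (c ^+ 2 - 1) by lra.
have : (2 - c) ^+ 2 <= Num.sqrt (c ^+ 2 - 1) ^+ 2 by rewrite ler_pXn2r ?nnegrE //; lra.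
case: (leP 0 (c ^+ 2 - 1)) => [ge0|lt0]; first by rewrite sqr_sqrtr //; lra.
by rewrite ltr0_sqrtr // in e3; lra.
Qed.
End Coordinates.

(** * Labels and counting *)

(* [None] on the layer between the [kap]-thick and the [kap']-thick walls.  Inside the
   thin walls two points can only be separated by walls of colour [false], hence
   the label for [false] there. *)
Definition piece_label (R : realType) (b : nat) (G kap kap' x h : R) :
    option (bool * option (int * nat)) :=
  let a := level b G h in
  if `[< walled b G kap x h >] then Some (true, label b false a (cell_index b a x))
  else if `[< walled b G kap' x h >] then None
  else Some (false, label b true a (cell_index b a x)).

Lemma piece_label_eq (R : realType) b (G kap kap' x h : R) l :
  piece_label b G kap kap' x h = Some l ->
  label b (~~ l.1) (level b G h) (cell_index b (level b G h) x) = l.2.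
Proof. by rewrite /piece_label; case: asboolP => _; [|case: asboolP => // _] => -[<-]. Qed.

(** Labels of different kinds would put one point in the thin walls and the other outside the thick
    ones, against [walled_widen]; for equal kinds, [walled_label] applies at thickness [kap] and
    [unwalled_label] at [kap']. *)
Lemma piece_label_close (R : realType) b (E G kap kap' x h x' h' : R) l l' :
  (1 < b)%N -> 1 <= E -> E ^+ 2 <= kap -> 2 * E * kap <= kap' ->
  4 * kap' ^+ 2 <= G -> E * kap' < b%:R ->
  0 <= x -> 0 < h -> 0 <= x' -> 0 < h' -> close E x h x' h' ->
  piece_label b G kap kap' x h = Some l -> piece_label b G kap kap' x' h' = Some l' -> l = l'.
Proof.
move=> b1 E1 Ekap kk kG kb x0 h0 x0' h0' cl.
have E0 : 0 < E by exact: lt_le_trans E1.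
have kap1 : 1 <= kap by apply: le_trans Ekap; rewrite exprn_ege1.
have kap0 : 0 < kap by exact: lt_le_trans kap1.
have le_kk : kap <= kap'.
  by apply: le_trans kk; rewrite ler_peMl ?ltW //; lra.
have kap0' : 0 < kap' by exact: lt_le_trans le_kk.
have Ekap' : E ^+ 2 <= kap' by exact: le_trans le_kk.
have kG1 : 4 * kap ^+ 2 <= G.
  by apply: le_trans kG; rewrite ler_pM2l // ler_pXn2r // nnegrE ltW.
have kb1 : E * kap < b%:R by apply: le_lt_trans kb; rewrite ler_pM2l.
have G0 : 0 < G by apply: lt_le_trans kG; rewrite mulr_gt0 // exprn_gt0.
have b0 := ltnW b1.
have Gh : 0 < G * h by rewrite mulr_gt0.
have Gh' : 0 < G * h' by rewrite mulr_gt0.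
have lev := levelP b1 Gh; have lev' := levelP b1 Gh'.
have ix := cell_indexP (level b G h) b0 x0.
have ix' := cell_indexP (level b G h') b0 x0'.
have widen y t y' t' : 0 < t -> 0 < t' -> close E y t y' t' ->
    walled b G kap y t -> walled b G kap' y' t'.
  move=> t0 t0' clt /(walled_widen b1 E1 Ekap kG1 t0 t0' clt).
  exact: walled_mono.
rewrite /piece_label.
case: asboolP => [wd|nwd]; [|case: asboolP => // nwd2] => -[<-].
- case: asboolP => [wd'|nwd']; [|case: asboolP => // nwd2'] => -[<-].
    by rewrite (walled_label b1 E1 Ekap kG1 kb1 h0 h0' cl lev lev' ix ix' wd wd').
  by case: nwd2'; exact: widen cl wd.
- case: asboolP => [wd'|nwd']; [|case: asboolP => // nwd2'] => -[<-].
    by case: nwd2; apply: widen (close_sym cl) wd'.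
  by rewrite (unwalled_label b1 E1 Ekap' kG kb h0 h0' cl lev lev' ix ix' nwd2 nwd2').
Qed.

Lemma truncn_eq_close (R : realType) (mu y y' : R) : 0 < mu -> 0 <= y -> 0 <= y' ->
  Num.truncn (y / mu) = Num.truncn (y' / mu) -> `|y - y'| < mu.
Proof.
move=> mu0 y0 y0' eq_t.
have /andP[] := truncn_itv (divr_ge0 y0 (ltW mu0)).
have /andP[] := truncn_itv (divr_ge0 y0' (ltW mu0)).
rewrite eq_t; set m := Num.truncn _.
rewrite ler_pdivlMr // ltr_pdivrMr // ler_pdivlMr // ltr_pdivrMr //.
by rewrite -natr1 mulrDl ltr_norml; lra.
Qed.

(* [h], [h'] and [S] are two heights and the squared distance of the horospherical
   coordinates; [5 / 4 <= M] is 1-separation and [mu] the mesh of the fine grid. *)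
Lemma crowded (R : realFieldType) (mu N h h' S M : R) :
  0 < mu -> 1 <= N -> 2 * N * mu <= h -> 2 * N * mu <= h' -> 5 / 4 <= M ->
  2 * h * h' * M = h ^+ 2 + h' ^+ 2 + S -> (h - h') ^+ 2 <= mu ^+ 2 ->
  S <= (N - 1) * mu ^+ 2 -> False.
Proof.
move=> mu0 N1 lh lh' M54 eqS dh2 S1.
have N0 : 0 < N by exact: lt_le_trans N1.
have k0 : 0 < 2 * N * mu by rewrite !mulr_gt0.
have h0 := lt_le_trans k0 lh; have h0' := lt_le_trans k0 lh'.
have hh : (2 * N * mu) ^+ 2 <= h * h' by rewrite expr2 ler_pM // ltW.
have hM : 2 * h * h' * (5 / 4) <= 2 * h * h' * M by rewrite ler_pM2l ?mulr_gt0.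
rewrite sqrrB in dh2; rewrite eqS in hM.
have tot : h * h' / 2 <= N * mu ^+ 2 by lra.
have : N * mu ^+ 2 <= N ^+ 2 * mu ^+ 2.
  by rewrite ler_pM2r ?exprn_gt0 // expr2 ler_peMl // ltW.
have : 0 < N * mu ^+ 2 by rewrite mulr_gt0 // exprn_gt0.
rewrite !exprMn in hh; lra.
Qed.

(** * Counting separated points in a ball *)

Section Counting.
Context (R : realType) (n b g : nat).
Hypotheses (b1 : (1 < b)%N) (g0 : (0 < g)%N).
Let G : R := g%:R.
Let b0 : (0 < b)%N. Proof. exact: ltnW. Qed.
Let G0 : 0 < G. Proof. by rewrite ltr0n. Qed.
Implicit Types v w : 'rV[R]_n.+3.

Definition level_of v : int := level b G (height v).
Definition index_of v (j : 'I_n.+1) : nat := cell_index b (level_of v) `|horo v j|.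

(** The denominator puts every height of level [a] above [2 * n.+2 * mesh a], as [crowded]
    requires. *)
Definition mesh (a : int) : R := b%:R ^ (a - 1) / (2 * n.+2 * g)%:R.
Definition fine_height v : nat := Num.truncn (height v / mesh (level_of v)).
Definition fine_horo v j : nat :=
  Num.truncn ((`|horo v j| - (index_of v j)%:R * b%:R ^ (level_of v)) / mesh (level_of v)).
Definition fine_count := (2 * n.+2 * g * b)%N.

Lemma mesh_gt0 a : 0 < mesh a.
Proof. by rewrite divr_gt0 ?exprz_gt0 ?ltr0n // !muln_gt0 g0. Qed.

Lemma fine_countE a : fine_count%:R * mesh a = b%:R ^ a.
Proof.
rewrite /mesh /fine_count natrM mulrC -mulrA mulKf; last first.
  by rewrite pnatr_eq0 -lt0n !muln_gt0 g0.
by rewrite mulrC -scale_split.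
Qed.

Lemma at_level_of v : hyperbolic_space v -> at_level b G (level_of v) (height v).
Proof. by move=> hv; apply: levelP; rewrite // mulr_gt0 // height_gt0. Qed.

Lemma in_cell_of v j : in_cell b (level_of v) (index_of v j) `|horo v j|.
Proof. exact: cell_indexP. Qed.

Lemma fine_height_bound v : hyperbolic_space v -> (fine_height v <= fine_count)%N.
Proof.
move=> hv; rewrite /fine_height truncn_le_nat -natr1 ltr_pdivrMr ?mesh_gt0 //.
rewrite mulrDl fine_countE mul1r.
have /andP[_ hi] := at_level_of hv.
have : height v <= G * height v by rewrite ler_peMl ?ler1n // ltW // height_gt0.
move=> hG; apply: (le_lt_trans hG); apply: (le_lt_trans hi).
by rewrite ltrDl mesh_gt0.
Qed.

Lemma fine_horo_bound v j : (fine_horo v j <= fine_count)%N.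
Proof.
rewrite /fine_horo truncn_le_nat -natr1 ltr_pdivrMr ?mesh_gt0 //.
rewrite mulrDl fine_countE mul1r.
have /andP[_] := in_cell_of v j; rewrite -natr1 mulrDl mul1r => xk.
by rewrite ltrBlDl addrA; apply: (lt_trans xk); rewrite ltrDl mesh_gt0.
Qed.

(** Cells see only [|horo v j|], so the signs are compared separately; the points then share a box
    too small for [crowded]. *)
Lemma separated_fine v w : hyperbolic_space v -> hyperbolic_space w -> 1 <= hdist v w ->
  level_of v = level_of w -> fine_height v = fine_height w ->
  (forall j, index_of v j = index_of w j) -> (forall j, fine_horo v j = fine_horo w j) ->
  (forall j, (0 <= horo v j) = (0 <= horo w j)) -> False.
Proof.
move=> hv hw sep lev fh ix fx sg.
have h0 := height_gt0 hv; have h0' := height_gt0 hw.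
have m0 := mesh_gt0 (level_of v); set mu := mesh (level_of v) in m0.
have dh : `|height v - height w| < mu.
  by apply: truncn_eq_close; rewrite ?ltW // -/(fine_height v) fh /fine_height -lev.
have dx j : (horo v j - horo w j) ^+ 2 <= mu ^+ 2.
  rewrite -(real_normK (num_real _)) ler_pXn2r ?nnegrE ?normr_ge0 ?(ltW m0) //.
  suff : `| `|horo v j| - `|horo w j| | <= mu.
    have := sg j; case: (ger0P (horo w j)) => _; case: (ger0P (horo v j)) => // _ _.
    by rewrite -opprD normrN.
  have /andP[x1 _] := in_cell_of v j; have /andP[x2 _] := in_cell_of w j.
  rewrite -lev -ix in x2.
  set c := (index_of v j)%:R * b%:R ^ level_of v in x1 x2.
  have : `|(`|horo v j| - c) - (`|horo w j| - c)| < mu.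
    apply: truncn_eq_close; rewrite ?subr_ge0 //.
    by have := fx j; rewrite /fine_horo -lev -ix.
  by rewrite opprB addrA subrK => /ltW.
have M54 := hdist_ge1 hv hw sep.
have := minkowski_horo hv hw.
set S := \sum_(_ < _) _ => eqS.
have S1 : S <= n.+1%:R * mu ^+ 2.
  rewrite mulr_natl -[X in _ *+ X](card_ord n.+1) -sumr_const; exact: ler_sum.
have low u : hyperbolic_space u -> level_of v = level_of u -> 2 * n.+2%:R * mu <= height u.
  move=> hu eu; have /andP[lo _] := at_level_of hu; rewrite -eu in lo.
  apply: ltW; rewrite -(ltr_pM2l G0); apply: le_lt_trans lo.
  rewrite mulrA [G * _]mulrC -!natrM /mu /mesh mulrC divfK //.
  by rewrite pnatr_eq0 -lt0n !muln_gt0 g0.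
have lv := low v hv erefl; have lw := low w hw lev.
have dh2 : (height v - height w) ^+ 2 <= mu ^+ 2.
  by rewrite -(real_normK (num_real _)) ler_pXn2r ?nnegrE ?normr_ge0 ?(ltW m0) // ltW.
apply: (crowded m0 _ lv lw M54 eqS dh2); first by rewrite ler1n.
by rewrite -(natr1 n.+1) addrK.
Qed.
Lemma level_of_ball v w (c : R) q : hyperbolic_space v -> hyperbolic_space w ->
  minkowski v w <= c -> 2 * c <= b%:R ^+ q ->
  level_of w <= level_of v + q%:Z /\
  forall j, `| `|horo v j| - `|horo w j| | <= b%:R ^ (level_of v + q%:Z).
Proof.
move=> hv hw; rewrite minkowski_sym => le_c cq.
have [hh hx] := horo_bound hw hv le_c.
have h0 := height_gt0 hv; have Gh0 : 0 < G * height v by rewrite mulr_gt0.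
have /andP[_ hi] := at_level_of hv; have /andP[lo _] := at_level_of hw.
have top y : y <= 2 * c * (G * height v) -> y <= b%:R ^ (level_of v + q%:Z).
  move=> le1; apply: (le_trans le1).
  rewrite expfzDr ?pnatr_eq0 -?lt0n // mulrC -exprnP.
  apply: (@le_trans _ _ (G * height v * b%:R ^+ q)); first by rewrite ler_pM2l.
  by rewrite ler_pM2r // exprn_gt0 // ltr0n.
split.
  have : level_of w - 1 < level_of v + q%:Z.
    rewrite -(@ltr_eXz2l R b%:R) ?ltr1n //; apply: (lt_le_trans lo).
    by apply: top; rewrite mulrCA ler_pM2l.
  by rewrite ltrBlDr ltzD1.
move=> j; apply: top; apply: (le_trans (ler_dist_dist _ _)); rewrite distrC.
apply: (le_trans (hx j)); rewrite mulrCA ler_peMl ?ler1n //.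
by apply: le_trans (hx j); exact: normr_ge0.
Qed.

Lemma neighbour_index a k m (x y : R) : in_cell b a k x -> in_cell b a m y ->
  `|x - y| <= b%:R ^ a -> k \in [:: m.-1; m; m.+1].
Proof.
have w0 : 0 < b%:R ^ a :> R by rewrite exprz_gt0 // ltr0n.
move=> /andP[x1 x2] /andP[y1 y2]; rewrite ler_norml => /andP[d1 d2].
have km : (k%:R : R) < m.+2%:R.
  by rewrite -(ltr_pM2r w0) -(natr1 m.+1) mulrDl; lra.
have mk : (m%:R : R) < k.+2%:R.
  by rewrite -(ltr_pM2r w0) -(natr1 k.+1) mulrDl; lra.
move: km mk; rewrite !ltr_nat !inE; clear; lia.
Qed.

(* The indices at level [a] of the points of label [l] in a ball whose radius
   corresponds to [q] levels, found below the three cells [q] levels above [v]. *)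
Definition candidates v q a j i l : seq nat :=
  flatten [seq label_class b i a (absz (level_of v + q%:Z - a)%R) m l
          | m <- let m := cell_index b (level_of v + q%:Z) `|horo v j| in [:: m.-1; m; m.+1]].

Lemma size_candidates v q a j i l : (absz (level_of v + q%:Z - a)%R <= q.*2)%N ->
  (size (candidates v q a j i l) <= 24 * b * q.*2.+1)%N.
Proof.
rewrite /candidates /=; move: (cell_index _ _ _) => m; set t := absz _ => tq.
have := size_label_class i a t m.-1 l b1; have := size_label_class i a t m l b1.
have := size_label_class i a t m.+1 l b1.
move: (label_class _ _ _ _ _ _) (label_class _ _ _ _ _ _) (label_class _ _ _ _ _ _) => D1 D2 D3.
have : (8 * b * t.+1 <= 8 * b * q.*2.+1)%N by rewrite leq_mul2l ltnS tq orbT.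
have -> : (24 * b * q.*2.+1 = 3 * (8 * b * q.*2.+1))%N by rewrite !mulnA.
rewrite !size_cat /=.
move: (8 * b * q.*2.+1)%N (8 * b * t.+1)%N => N1 N2; clear; lia.
Qed.

Lemma mem_candidates v w q j i (c : R) : hyperbolic_space v -> hyperbolic_space w ->
  minkowski v w <= c -> 2 * c <= b%:R ^+ q ->
  index_of w j \in candidates v q (level_of w) j i (label b i (level_of w) (index_of w j)).
Proof.
move=> hv hw le_c cq; have [lev dx] := level_of_ball hv hw le_c cq.
set a := level_of w in lev *; set A := level_of v + q%:Z in lev dx.
apply/flattenP; exists (label_class b i a (absz (A - a)) (index_of w j %/ b ^ absz (A - a))%N
  (label b i a (index_of w j))); last exact: mem_label_class.
apply/mapP; exists (index_of w j %/ b ^ absz (A - a))%N => //.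
have tE : a + (absz (A - a))%:Z = A by clear -lev; lia.
apply: (@neighbour_index A _ _ `|horo w j| `|horo v j|).
- by have := in_cell_ancestor (absz (A - a)) b0 (in_cell_of w j); rewrite -/a tE.
- exact: cell_indexP.
- by rewrite distrC.
Qed.

(** Candidate lists depend on a point only through its level, so the level and a position in the
    list recover the index; [separated_fine] then makes [code] injective. *)
Lemma ball_count v (c : R) q (i : 'I_n.+1 -> bool) (l : 'I_n.+1 -> option (int * nat))
    (s : seq 'rV[R]_n.+3) : hyperbolic_space v -> 2 * c <= b%:R ^+ q -> uniq s ->
  (forall w, w \in s -> [/\ hyperbolic_space w, minkowski v w <= c &
     forall j, label b (i j) (level_of w) (index_of w j) = l j]) ->
  {in s &, forall u w, u <> w -> 1 <= hdist u w} ->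
  (size s <= q.*2.+1 * fine_count.+1 *
             ((24 * b * q.*2.+1).+1 * 2 * fine_count.+1) ^ n.+1)%N.
Proof.
move=> hv cq us sP sep.
(* Levels in the ball differ from that of [v] by at most [q], so their offsets from [A0] take
   [q.*2.+1] values. *)
pose K := (24 * b * q.*2.+1)%N; pose A0 := level_of v - q%:Z.
pose cand w j := candidates v q (level_of w) j (i j) (l j).
pose code w : 'I_q.*2.+1 * 'I_fine_count.+1 *
    {ffun 'I_n.+1 -> 'I_K.+1 * bool * 'I_fine_count.+1} :=
  (inord (absz (level_of w - A0)), inord (fine_height w),
   [ffun j => (inord (index (index_of w j) (cand w j)), 0 <= horo w j, inord (fine_horo w j))]).
have lev w : w \in s -> A0 <= level_of w /\ (absz (level_of w - A0)%R <= q.*2)%N.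
  move=> /sP[hw le_c _]; have [le1 _] := level_of_ball hv hw le_c cq.
  rewrite minkowski_sym in le_c; have [le2 _] := level_of_ball hw hv le_c cq.
  by rewrite /A0; clear -le1 le2; lia.
have memc w j : w \in s -> index_of w j \in cand w j.
  move=> /sP[hw le_c lw].
  by rewrite /cand -(lw j); apply: mem_candidates le_c cq.
have sizec w j : w \in s -> (size (cand w j) <= K)%N.
  move=> ws; apply: size_candidates.
  by have [h1 h2] := lev w ws; rewrite /A0 in h1 h2; clear -h1 h2; lia.
have inj : {in s &, injective code}.
  move=> u w us' ws [] /(congr1 val) /= e1 /(congr1 val) /= e2 e3.
  have [hu _ _] := sP u us'; have [hw _ _] := sP w ws.
  apply: contrapT => neq.
  have [lu1 lu2] := lev u us'; have [lw1 lw2] := lev w ws.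
  rewrite !inordK ?ltnS // in e1.
  rewrite !inordK ?ltnS ?fine_height_bound // in e2.
  have el : level_of u = level_of w by clear -e1 lu1 lw1; lia.
  have ec j : cand u j = cand w j by rewrite /cand el.
  have e4 j := congr1 (fun f : {ffun _ -> _} => f j) e3.
  apply: (separated_fine hu hw (sep u w us' ws neq) el e2) => j;
    move: (e4 j); rewrite !ffunE => -[] /(congr1 val) /= f1 f2 /(congr1 val) /= f3 //.
    rewrite !inordK ?ltnS in f1; last 2 first.
    - by apply: leq_trans (sizec w j ws); apply/ltnW; rewrite index_mem memc.
    - by apply: leq_trans (sizec u j us'); apply/ltnW; rewrite index_mem memc.
    by rewrite -(nth_index 0%N (memc u j us')) f1 ec nth_index // memc.
  by rewrite !inordK ?ltnS ?fine_horo_bound // in f3.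
rewrite -(size_map code).
have <- : #|[seq code w | w <- s]| = size [seq code w | w <- s].
  by apply/card_uniqP; rewrite map_inj_in_uniq.
apply: (leq_trans (max_card _)).
by rewrite !card_prod card_ffun !card_prod !card_ord card_bool.
Qed.
End Counting.

(** * Numerical bounds *)

Lemma affine_exp_bound (R : realFieldType) (m : nat) (rho : R) : 0 <= rho ->
  (2 * rho + 3) ^+ m <= 5 ^+ m * rho ^+ m + 5 ^+ m.
Proof.
move=> rho0; case: (leP rho 1) => r1.
  apply: (@le_trans _ _ (5 ^+ m)).
    by apply: lerXn2r; rewrite ?nnegrE //; lra.
  by rewrite lerDr mulr_ge0 ?exprn_ge0.
apply: (@le_trans _ _ ((5 * rho) ^+ m)).
  by apply: lerXn2r; rewrite ?nnegrE ?mulr_ge0 //; lra.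
by rewrite exprMn lerDl exprn_ge0.
Qed.

(** The level and each of the [n.+1] coordinates give one factor linear in [rho]; the 50 comes from
    [2 * (24 * u + 1) <= 50 * u] for [u >= 1]. *)
Lemma size_bound_real (R : realType) (N b F n q : nat) (rho : R) : 0 <= rho -> (0 < b)%N ->
  q%:R <= rho + 1 ->
  (N <= q.*2.+1 * F * ((24 * b * q.*2.+1).+1 * 2 * F) ^ n.+1)%N ->
  N%:R <= (F * (50 * b * F) ^ n.+1 * 5 ^ n.+2)%N%:R * rho ^+ n.+2
          + (F * (50 * b * F) ^ n.+1 * 5 ^ n.+2)%N%:R.
Proof.
move=> rho0 b0 qr leN; set C := (_ * 5 ^ _)%N%:R.
have : (N <= F * (50 * b * F) ^ n.+1 * q.*2.+1 ^ n.+2)%N.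
  apply: (leq_trans leN).
  have -> : (F * (50 * b * F) ^ n.+1 * q.*2.+1 ^ n.+2 =
     q.*2.+1 * F * (50 * b * q.*2.+1 * F) ^ n.+1)%N.
    by rewrite (expnS _ n.+1) !expnMn; move: (_ ^ _)%N => u; ring.
  rewrite leq_mul2l; apply/orP; right; rewrite leq_exp2r // leq_mul2r; apply/orP; right.
  have : (0 < b * q.*2.+1)%N by rewrite muln_gt0 b0.
  rewrite -[(24 * b * _)%N]mulnA -[(50 * b * _)%N]mulnA.
  by move: (b * _)%N => u; clear; lia.
rewrite -(ler_nat R) => /le_trans; apply.
have -> : C = (F * (50 * b * F) ^ n.+1)%:R * 5 ^+ n.+2 by rewrite /C natrM natrX.
rewrite natrM -mulrA -mulrDr; apply: ler_wpM2l => //.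
apply: le_trans (affine_exp_bound n.+2 rho0); rewrite natrX.
apply: lerXn2r; rewrite ?nnegrE ?addr_ge0 ?mulr_ge0 //.
by rewrite -natr1 -mul2n natrM; lra.
Qed.

Lemma expR_le_scale (R : realType) (b : nat) (rho : R) : 2 * expR 1 <= b%:R :> R ->
  2 * expR rho <= b%:R ^+ (Num.truncn rho).+1.
Proof.
move=> be; set q := (Num.truncn rho).+1.
apply: (@le_trans _ _ ((2 * expR 1) ^+ q)); last first.
  by apply: lerXn2r; rewrite ?nnegrE ?mulr_ge0 ?expR_ge0.
rewrite exprMn -expRM_natl mulr1; apply: ler_pM; rewrite ?expR_ge0 //.
  by rewrite exprS ler_peMr // exprn_ege1 // ler1n.
by rewrite ler_expR ltW // truncnS_gt.
Qed.

Lemma hdist_close (R : realType) (n : nat) (v w : 'rV[R]_n.+3) (r : R) (j : 'I_n.+1) :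
  hyperbolic_space v -> hyperbolic_space w -> hdist v w <= r ->
  close (2 * expR r) `|horo v j| (height v) `|horo w j| (height w).
Proof.
move=> hv hw /(hdist_le hv hw) le_c.
have [h1 x1] := horo_bound hv hw le_c.
rewrite minkowski_sym in le_c; have [h2 x2] := horo_bound hw hv le_c.
split=> //; apply: (le_trans (ler_dist_dist _ _)) => //.
by rewrite distrC.
Qed.

(** * Choice of constants and the cover of [X] *)

Local Open Scope classical_set_scope.

Theorem theoremE (R : realType) (d : nat) (hd : (2 <= d)%N)
    (X : set 'rV[R]_d.+1) (hX : maximal_1_separated X) :
  asdim_poly_le (@hdist R d) X d d.-1.
Proof.
case: d hd X hX => [|[|n]] // _ X [XH [sep _]] r r0.
(* The ratio [2 * E] of successive thicknesses is the one in [walled_widen]; starting at exponent 2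
   ensures [E ^ 2 <= kap t]. *)
pose E : R := 2 * expR r; pose kap t : R := (2 * E) ^+ t.+2.
pose kmax := kap n.+2.
pose g := (Num.truncn (4 * kmax ^+ 2)).+1.
(* [E * kmax < b] serves the walls, and [2 * expR 1 <= b] lets radius [rho] span about [rho]
   levels. *)
pose b := (Num.truncn (E * kmax + 2 * expR 1)).+2.
have E1 : 1 <= E by have := expR_ge1Dx r; rewrite /E; lra.
have E20 : 1 <= 2 * E by lra.
have E0 : 0 < E by lra.
have kap_mono t t' : (t <= t')%N -> kap t <= kap t'.
  by move=> tt; rewrite /kap ler_weXn2l // !ltnS.
have kap0 t : 0 < kap t by rewrite exprn_gt0 // mulr_gt0.
have km0 : 0 < kmax by exact: kap0.
have b1 : (1 < b)%N by [].
have g0 : (0 < g)%N by [].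
have e0 : 0 < expR 1 :> R by exact: expR_gt0.
have bE : E * kmax + 2 * expR 1 < b%:R.
  by apply: (lt_trans (truncnS_gt _)); rewrite ltr_nat.
have bE1 : 2 * expR 1 <= b%:R :> R.
  by apply: le_trans (ltW bE); rewrite lerDr mulr_ge0 ?ltW.
have bE2 : E * kmax < b%:R by apply: le_lt_trans bE; rewrite lerDl mulr_ge0 ?ltW.
have gE : 4 * kmax ^+ 2 <= g%:R by apply/ltW/truncnS_gt.
have Ekap t : E ^+ 2 <= kap t.
  apply: (@le_trans _ _ ((2 * E) ^+ 2)); last by rewrite ler_weXn2l.
  have E2 : E <= 2 * E by rewrite ler_peMl ?ler1n // ltW.
  by rewrite ler_pXn2r // nnegrE ltW // mulr_gt0.
pose L t (v : 'rV[R]_n.+3) j :=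
  piece_label b g%:R (kap t) (kap t.+1) `|horo v j| (height v).
pose piece t Lam := [set v | X v /\ forall j, L t v j = Some (Lam j)].
have Lclose (t : 'I_n.+2) v w j l l' : X v -> X w -> hdist v w <= r ->
    L t v j = Some l -> L t w j = Some l' -> l = l'.
  move=> /XH hv /XH hw dvw.
  have kt : kap t.+1 <= kmax by exact: kap_mono.
  apply: (@piece_label_close R b E g%:R (kap t) (kap t.+1)) => //.
  - apply: le_trans gE; rewrite ler_pM2l //.
    by apply: lerXn2r; rewrite ?nnegrE // ltW.
  - by apply: le_lt_trans bE2; rewrite ler_pM2l.
  - exact: height_gt0.
  - exact: height_gt0.
  - exact: hdist_close.
(* The [None] layers lie between consecutive thicknesses, hence are disjoint for different
   colours. *)
have Lnone v j (t t' : 'I_n.+2) : X v -> L t v j = None -> L t' v j = None -> t = t'.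
  move=> /XH hv.
  have none u : L u v j = None -> ~ walled b g%:R (kap u) `|horo v j| (height v) /\
      walled b g%:R (kap u.+1) `|horo v j| (height v).
    by rewrite /L /piece_label; do 2 case: asboolP => //.
  have asym (u u' : nat) : (u < u')%N -> L u v j = None -> L u' v j = None -> False.
    move=> uu /none[_ w1] /none[w2 _]; apply: w2.
    apply: walled_mono w1 => //; first exact: kap_mono.
    exact: height_gt0.
  move=> n1 n2; apply: val_inj; case: (ltngtP t t') => // tt.
    by case: (asym _ _ tt n1 n2).
  by case: (asym _ _ tt n2 n1).
have cover v : X v -> exists t : 'I_n.+2, forall j, L t v j <> None.
  move=> Xv; apply: contrapT => /forallNP nt.
  (* Pigeonhole: a bad coordinate for every colour would inject [n.+2] colours into [n.+1]
     coordinates. *)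
  have /choice[f fP] : forall t : 'I_n.+2, exists j, L t v j = None.
    by move=> t; have /existsNP[j /contrapT nj] := nt t; exists j.
  have /leq_card : injective f.
    by move=> t t' ff; apply: (Lnone v (f t)) => //; rewrite ff.
  by rewrite !card_ord ltnn.
exists (fun t => [set U | exists Lam, U = piece t Lam]).
split; [|split; [|split; [|split]]].
- move=> v Xv; have [t tP] := cover v Xv; exists t.
  have /choice[Lam LamP] : forall j, exists l, L t v j = Some l.
    by move=> j; case: (L t v j) (tP j) => // l _; exists l.
  by exists (piece t Lam); [exists Lam|].
- by move=> t U [Lam ->] v [].
- move=> t U V [Lam ->] [Lam' ->] neq; apply/seteqP; split => // v [[_ h1] [_ h2]].
  apply: neq; congr piece; apply: funext => j.
  by apply: Some_inj; rewrite -h1 -h2.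
- move=> t U V [Lam ->] [Lam' ->] neq u v [Xu h1] [Xv h2].
  rewrite leNgt; apply/negP => /ltW duv; apply: neq; congr piece; apply: funext => j.
  exact: Lclose duv (h1 j) (h2 j).
pose F := (fine_count n b g).+1.
exists (F * (50 * b * F) ^ n.+1 * 5 ^ n.+2)%N%:R => t U x rho [Lam ->] [Xx _] rho0 s us sP.
apply: (@size_bound_real R _ b F n (Num.truncn rho).+1 rho) => //.
  by rewrite -natr1 lerD2r; have /andP[] := truncn_itv rho0.
apply: (@ball_count R n b g b1 g0 x (expR rho) _ (fun j => ~~ (Lam j).1) (fun j => (Lam j).2)) => //.
- exact: XH.
- exact: expR_le_scale.
- move=> w /sP[[Xw lw] dw]; split; first exact: XH.
    by apply: hdist_le => //; exact: XH.
  by move=> j; exact: piece_label_eq (lw j).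
- by move=> u w /sP[[Xu _] _] /sP[[Xw _] _]; exact: sep.
Qed.
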